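(* Let $X$ be a set, let $k\geq 1$ be an integer, and let $f:X^{k}\rightarrow X$ be a function. If $f$ is induced involutory (II), i.e. involutory in each of its $k$ arguments when the other arguments are held fixed at arbitrary values, then $f$ is $(k+1)$-involutory, i.e. $f^{k+1}=\mathrm{id}_{X^{k}}$, where $f^{k+1}$ denotes the $(k+1)$-th iterate of $f$ in the sense defined in the context.
   Context: Iterates of a function $f:X^{k}\rightarrow X$. Define the self-map $f^{1}:X^{k}\rightarrow X^{k}$ by $f^{1}(x_{1},\dots,x_{k})=(f^{1}_{1},\dots,f^{1}_{k})$, where recursively $$f^{1}_{1}=f(x_{1},x_{2},\dots,x_{k}),\qquad f^{1}_{j}=f(x_{j},x_{j+1},\dots,x_{k},f^{1}_{1},f^{1}_{2},\dots,f^{1}_{j-1})\quad (2\leq j\leq k),$$ so that in particular $f^{1}_{k}=f(x_{k},f^{1}_{1},\dots,f^{1}_{k-1})$. (Thus $f^{1}$ maps $k$ consecutive terms of the recurrence $a_{n+k}=f(a_{n},\dots,a_{n+k-1})$ to the next $k$ consecutive terms.) For a nonnegative integer $n$, the $n$-th iterate $f^{n}:X^{k}\to X^{k}$ is the usual $n$-fold composition of the self-map $f^{1}$ with itself, with $f^{0}=\mathrm{id}_{X^{k}}$. For $k=1$ this is ordinary iteration of a self-map. The function $f:X^{k}\to X$ is $n$-involutory (involutory of order $n$) when $f^{n}=\mathrm{id}_{X^{k}}$; $n$ is not required to be minimal. Induced involutory. For $j\in\{1,\dots,k\}$ and fixed values $x_{-j}=(x_{i})_{i\neq j}\in X^{k-1}$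 of the other arguments, let $f_{j}(\cdot\,|\,x_{-j}):X\to X$ be the self-map $x_{j}\mapsto f(x_{1},\dots,x_{k})$. The function $f$ is induced involutory (II) when for every $j\in\{1,\dots,k\}$ and every $x_{-j}\in X^{k-1}$ the self-map $f_{j}(\cdot\,|\,x_{-j})$ is an involution, i.e. its composition with itself is $\mathrm{id}_{X}$. *)

(* Defs.v *)
From mathcomp Require Import all_boot.

Set Implicit Arguments.
Unset Strict Implicit.
Unset Printing Implicit Defensive.

Section Iterates.

Variables (X : Type) (k : nat) (f : k.-tuple X -> X).

(* [iterate_prefix x jk] is (f^1_1, ..., f^1_j) for jk : j <= k.  The argument *)
(* of f producing the next term is (x_{j+1}, ..., x_k, f^1_1, ..., f^1_j).     *)
Fixpoint iterate_prefix (x : k.-tuple X) (j : nat) : j <= k -> j.-tuple X :=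
  match j return j <= k -> j.-tuple X with
  | 0 => fun _ => [tuple]
  | j'.+1 => fun jk =>
      let s := iterate_prefix x (ltnW jk) in
      [tuple of rcons s (f (tcast (subnK (ltnW jk)) [tuple of drop j' x ++ s]))]
  end.

Definition iterate1 (x : k.-tuple X) : k.-tuple X :=
  iterate_prefix x (leqnn k).

Definition iterate (n : nat) : k.-tuple X -> k.-tuple X := iter n iterate1.

(* Pointwise, so as not to depend on functional extensionality. *)
Definition n_involutory (n : nat) : Prop := iterate n =1 id.

(* The self-map y |-> f(x_1, ..., x_{j-1}, y, x_{j+1}, ..., x_k).  The k - 1   *)
(* fixed arguments are listed in z; [unlift j i] is None exactly when i = j,   *)
(* and otherwise is the rank of i among the indices different from j.          *)
Definition induced_map (j : 'I_k) (z : k.-1.-tuple X) (y : X) : X :=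
  f [tuple oapp (tnth z) y (unlift j i) | i < k].

Definition induced_involutory : Prop :=
  forall (j : 'I_k) (z : k.-1.-tuple X), involutive (induced_map j z).

Lemma take_iterate_prefix (x : k.-tuple X) (i j : nat)
    (ik : i <= k) (jk : j <= k) :
  i <= j -> take i (iterate_prefix x jk) = iterate_prefix x ik :> seq X.
Proof.
elim: j jk => [|j IH] jk.
  rewrite leqn0 => /eqP i0; subst i; by rewrite take0.
rewrite leq_eqVlt => /orP[/eqP ij|ij].
  by subst i; rewrite (bool_irrelevance ik jk) take_oversize ?size_tuple.
by rewrite /= -cats1 takel_cat ?size_tuple // (IH (ltnW jk)).
Qed.

(* The defining recursion, f^1_{j+1} = f(x_{j+1}, ..., x_k, f^1_1, ..., f^1_j). *)
Lemma tnth_iterate1 (x t : k.-tuple X) (j : 'I_k) :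
  t = drop j x ++ take j (iterate1 x) :> seq X -> tnth (iterate1 x) j = f t.
Proof.
move=> tE; have jk := ltn_ord j.
rewrite (tnth_nth (f t)) -(nth_take _ (ltnSn j)) /iterate1.
rewrite (take_iterate_prefix x jk (leqnn k) jk) /= nth_rcons size_tuple.
rewrite ltnn eqxx; congr f; apply: val_inj; rewrite /= val_tcast /= tE.
by rewrite /iterate1 (take_iterate_prefix x (ltnW jk) (leqnn k) (ltnW jk)).
Qed.

End Iterates.

(* Main.v *)
(* The graph of f, i.e. the set of the (k+1)-tuples (x_1, ..., x_k, f(x)), is   *)
(* stable under exchanging the last entry with any other one: this is what it   *)
(* means that f is induced involutory.  Composing the exchanges at positions    *)
(* k, ..., 1 shows that the graph is stable under cyclic rotation, so that the  *)
(* recurrence a_{n+k} = f(a_n, ..., a_{n+k-1}) has period k + 1.  On the graph, *)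
(* f^1 therefore acts as the rotation by one step to the right, which has order *)
(* k + 1.                                                                       *)
Require Import Defs.
From mathcomp Require Import all_boot.

(** In the word (x_1, ..., x_k, f(x)), any entry is the value of f on the remaining ones in order
    ([induced_involutory_delete]). For the entry x_1 this says that the recurrence continues with
    x_1 after f(x), then with x_2, and so on. So f^1(x) = (f(x), x_1, ..., x_{k-1}), and the
    injection [graph_seq] turns f^1 into the right rotation of words of length k + 1
    ([graph_seq_iterate1]). *)

Lemma rot_rcons (T : Type) (j : nat) (s : seq T) (y : T) :
  j <= size s ->
  rot j (rcons s y) = rcons (drop j s ++ take j (y :: s)) (nth y (y :: s) j).
Proof.
move=> js; rewrite rcons_cat -take_nth ?ltnS //= /rot drop_rcons // -cats1.
by rewrite -cats1 -catA takel_cat.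
Qed.

Lemma rot_iter_rotr1 (T : Type) (n : nat) (s : seq T) :
  n <= size s -> rot n (iter n (rotr 1) s) = s.
Proof.
have szE m : size (iter m (rotr 1) s) = size s.
  by elim: m => //= m IH; rewrite size_rotr.
elim: n => [|n IH] ns; first by rewrite rot0.
rewrite -addn1 rotD; first by rewrite addn1 iterS rotrK (IH (ltnW ns)).
by rewrite szE addn1.
Qed.

Definition graph_seq {X : Type} {k : nat} (f : k.-tuple X -> X)
  (x : k.-tuple X) : seq X := rcons x (f x).

Lemma size_graph_seq (X : Type) (k : nat) (f : k.-tuple X -> X)
    (x : k.-tuple X) :
  size (graph_seq f x) = k.+1.
Proof. by rewrite size_rcons size_tuple. Qed.

Lemma graph_seq_inj (X : Type) (k : nat) (f : k.-tuple X -> X) :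
  injective (graph_seq f).
Proof. by move=> x t /rcons_inj[/val_inj]. Qed.

Lemma graph_seqP (X : Type) (k : nat) (f : k.-tuple X -> X) (x : k.-tuple X)
    (s : seq X) (y : X) :
  graph_seq f x = rcons s y -> x = s :> seq X /\ f x = y.
Proof. by move=> /rcons_inj[]. Qed.

Section InducedInvolutory.

Variables (X : Type) (k : nat) (f : k.-tuple X -> X).
Hypothesis f_II : induced_involutory f.

(** With z the common entries of x and t away from j, f x and f t are the values of one involution
    [induced_map j z] at x_j and at f x. *)
Lemma induced_involutory_swap (x t : k.-tuple X) (j : 'I_k) :
    (forall i, i != j -> tnth t i = tnth x i) -> tnth t j = f x ->
  f t = tnth x j.
Proof.
move=> tx tj; pose z := [tuple tnth x (lift j i) | i < k.-1].
have induced_mapE u : (forall i, i != j -> tnth u i = tnth x i) ->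
    induced_map f j z (tnth u j) = f u.
  move=> ux; congr f; apply: eq_from_tnth => i; rewrite tnth_mktuple.
  by case: unliftP => [i'|] -> //=; rewrite tnth_mktuple ux // eq_sym neq_lift.
by rewrite -induced_mapE // tj -(induced_mapE x) // f_II.
Qed.

(** Descending induction on j from j = k, where t = x. The words left after deleting entry j.+1 or
    entry j differ only at position j, so one swap passes from the former to the latter. *)
Lemma induced_involutory_delete (x t : k.-tuple X) (j : nat) :
    j <= k ->
    t = take j (graph_seq f x) ++ drop j.+1 (graph_seq f x) :> seq X ->
  f t = nth (f x) (graph_seq f x) j.
Proof.
have sz := size_graph_seq _ _ f x.
move=> jk; rewrite -(subKn jk); move: (k - j) (leq_subr j k) => d {j jk}.
elim: d t => [|d IH] t dk.
  rewrite subn0 drop_oversize ?sz // cats0 /graph_seq -cats1.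
  rewrite take_size_cat ?size_tuple // => /val_inj->.
  by rewrite nth_cat size_tuple ltnn subnn.
set j := k - d.+1; have jE : k - d = j.+1 by rewrite /j subnSK.
have jk : j < k by rewrite -jE leq_subr.
rewrite jE in IH => tE.
have sz' : size (take j.+1 (graph_seq f x) ++ drop j.+2 (graph_seq f x)) == k.
  by rewrite size_cat size_take size_drop sz ltnS jk subSS subnKC.
have := IH (Tuple sz') (ltnW dk) erefl; set u := Tuple sz' => fu.
have nth_u i : nth (f x) u i =
    if i <= j then nth (f x) (graph_seq f x) i else nth (f x) (graph_seq f x) i.+1.
  rewrite nth_cat size_take sz ltnS jk ltnS; case: leqP => ij.
    by rewrite nth_take.
  by rewrite nth_drop addSn subnKC.
have nth_t i : nth (f x) t i =
    if i < j then nth (f x) (graph_seq f x) i else nth (f x) (graph_seq f x) i.+1.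
  rewrite tE nth_cat size_take sz (leq_trans jk) //.
  case: ltnP => ij; first by rewrite nth_take.
  by rewrite nth_drop addSn subnKC.
rewrite (@induced_involutory_swap u t (Ordinal jk)).
- by rewrite (tnth_nth (f x)) nth_u leqnn.
- move=> i ij; rewrite !(tnth_nth (f x)) nth_u nth_t [i <= j]leq_eqVlt.
  by rewrite (negPf (ij : i != j :> nat)).
by rewrite (tnth_nth (f x)) nth_t ltnn fu.
Qed.

Lemma graph_seq_rot1 (x : k.-tuple X) :
  exists t : k.-tuple X, graph_seq f t = rot 1 (graph_seq f x).
Proof.
have sz : size (behead (graph_seq f x)) == k.
  by rewrite size_behead size_graph_seq.
exists (Tuple sz); rewrite {1}/graph_seq.
rewrite (@induced_involutory_delete x _ 0) //=; last by rewrite take0 drop1.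
by rewrite /graph_seq; case: (val x) => [|a s] //=; rewrite rot1_cons.
Qed.

Lemma graph_seq_rot (x : k.-tuple X) (n : nat) :
  n <= k.+1 -> exists t : k.-tuple X, graph_seq f t = rot n (graph_seq f x).
Proof.
elim: n => [|n IH] nk; first by exists x; rewrite rot0.
have [t tE] := IH (ltnW nk); have [u uE] := graph_seq_rot1 t.
by exists u; rewrite uE tE -(add1n n) rotD // size_graph_seq.
Qed.

Lemma graph_seq_iterate1 (x : k.-tuple X) :
  graph_seq f (iterate1 f x) = rotr 1 (graph_seq f x).
Proof.
have sx : size x = k := size_tuple x.
have takeE j : j <= k -> take j (iterate1 f x) = take j (f x :: x).
  elim: j => [|j IH] jk; first by rewrite !take0.
  rewrite !(take_nth (f x)) ?size_tuple //=; last by rewrite ltnS ltnW.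
  rewrite (IH (ltnW jk)); congr rcons.
  (* By [rot_rcons], rotating by j lists the arguments of f that yield term j of f^1(x), followed by
     the value there. *)
  have [t] := @graph_seq_rot x j (leqW (ltnW jk)).
  rewrite rot_rcons ?sx 1?ltnW // => tfE; have [tE <-] := graph_seqP _ _ _ _ _ _ tfE.
  rewrite -(tnth_nth (f x) _ (Ordinal jk)).
  by apply: tnth_iterate1; rewrite tE (IH (ltnW jk)).
have iE : iterate1 f x = take k (f x :: x) :> seq X.
  by rewrite -takeE // take_oversize ?size_tuple.
(* Rotation by k leaves f^1(x) followed by x_k, hence f(f^1(x)) = x_k. *)
have [t] := @graph_seq_rot x k (leqnSn k).
rewrite rot_rcons ?sx // drop_oversize ?sx // cat0s -iE.
move=> tfE; have [/val_inj tE fE] := graph_seqP _ _ _ _ _ _ tfE.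
rewrite /graph_seq rotr1_rcons -tE fE tE iE -take_nth /= ?sx ?ltnS //.
by rewrite take_oversize // sx.
Qed.

Lemma induced_involutory_n_involutory : n_involutory f k.+1.
Proof.
move=> x; apply: (@graph_seq_inj _ _ f).
have iterE n : graph_seq f (iterate f n x) = iter n (rotr 1) (graph_seq f x).
  by elim: n => //= n IH; rewrite graph_seq_iterate1 -IH.
have sz := size_graph_seq _ _ f x.
(* Rotation by k + 1, the full length, is the identity and undoes the k + 1 right steps. *)
apply: (@rot_inj k.+1); rewrite iterE rot_iter_rotr1 ?sz //.
by rewrite -sz rot_size.
Qed.

End InducedInvolutory.

Theorem proposition2 (X : Type) (k : nat) (k_ge1 : 1 <= k)
    (f : k.-tuple X -> X) :
  induced_involutory f -> n_involutory f k.+1.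
Proof. exact: induced_involutory_n_involutory. Qed.
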